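(* (i) Let $d\ge 2$ and let $\rho_{AB}$ be any state on $\mathbb{C}^d\otimes\mathbb{C}^2$ (Alice holds the qudit, Bob the qubit). Let $\rho_A=\operatorname{Tr}_B[\rho_{AB}]$, $\mu_1\in[0,\tfrac{1}{\sqrt3}]$, and $\tau^1_{AB}=\mu_1\rho_{AB}+(1-\mu_1)\rho_A\otimes\tfrac{\mathbb{I}_2}{2}$. If $\tau^1_{AB}$ is entangled, then $\rho_{AB}$ is EPR steerable from Bob to Alice. (ii) Let $d\ge 2$ and let $\rho_{AB}$ be any state on $\mathbb{C}^2\otimes\mathbb{C}^d$ (Alice holds the qubit, Bob the qudit). Let $\rho_B=\operatorname{Tr}_A[\rho_{AB}]$, $\mu_2\in[0,\tfrac{1}{\sqrt3}]$, and $\tau^2_{AB}=\mu_2\rho_{AB}+(1-\mu_2)\tfrac{\mathbb{I}_2}{2}\otimes\rho_B$. If $\tau^2_{AB}$ is entangled, then $\rho_{AB}$ is EPR steerable from Alice to Bob.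
   Context: $\mathbb{I}_2$ is the $2\times2$ identity. Measurements are arbitrary POVMs $A=\{M^A_a\}$ on Alice's system and $B=\{M^B_b\}$ on Bob's system, with $P(a,b|A,B,\rho_{AB})=\operatorname{Tr}[(M^A_a\otimes M^B_b)\rho_{AB}]$. $\rho_{AB}$ is NOT EPR steerable from Bob to Alice iff there exist a distribution $P(\lambda)$, quantum states $\rho^A_\lambda$ on Alice's system and arbitrary distributions $P(b|B,\lambda)$ with $P(a,b|A,B,\rho_{AB})=\sum_\lambda P(\lambda)\operatorname{Tr}[\rho^A_\lambda M^A_a]P(b|B,\lambda)$ for all $A,B,a,b$; otherwise it is steerable from Bob to Alice. $\rho_{AB}$ is NOT EPR steerable from Alice to Bob iff there exist $P(\lambda)$, arbitrary distributions $P(a|A,\lambda)$ and quantum states $\rho^B_\lambda$ on Bob's system with $P(a,b|A,B,\rho_{AB})=\sum_\lambda P(\lambda)P(a|A,\lambda)\operatorname{Tr}[\rho^B_\lambda M^B_b]$ for all $A,B,a,b$; otherwise it is steerable from Alice to Bob. A bipartite state is separable if it is a convex combination of product states $\rho^A_\lambda\otimes\rho^B_\lambda$, and entangled otherwise. *)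

(* Defs.v *)
(* Complex numbers are modelled by an arbitrary
   numClosedFieldType C. *)
From HB Require Import structures.
From mathcomp Require Import all_boot all_order all_algebra.
Set Implicit Arguments. Unset Strict Implicit. Unset Printing Implicit Defensive.
Import Order.TTheory GRing.Theory Num.Theory.
Local Open Scope ring_scope.

Section Quantum.
Variable C : numClosedFieldType.

Definition adjmx (m n : nat) (A : 'M[C]_(m, n)) : 'M[C]_(n, m) :=
  (map_mx Num.conj A)^T.

Definition hermitian (n : nat) (A : 'M[C]_n) : Prop := adjmx A = A.

Definition psd (n : nat) (A : 'M[C]_n) : Prop :=
  hermitian A /\ forall v : 'cV[C]_n, 0 <= (adjmx v *m A *m v) 0 0.

Definition is_state (n : nat) (rho : 'M[C]_n) : Prop :=
  psd rho /\ \tr rho = 1.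

Definition is_POVM (n k : nat) (M : 'I_k -> 'M[C]_n) : Prop :=
  (forall a, psd (M a)) /\ \sum_(a < k) M a = 1%:M.

(* index decomposition of C^m (x) C^n, compatible with mathcomp's mxvec_index *)
Definition tens_idx (m n : nat) (p : 'I_(m * n)) : 'I_m * 'I_n :=
  enum_val (cast_ord (esym (mxvec_cast m n)) p).

Definition kron (m n : nat) (A : 'M[C]_m) (B : 'M[C]_n) : 'M[C]_(m * n) :=
  \matrix_(p, q) (A (tens_idx p).1 (tens_idx q).1 * B (tens_idx p).2 (tens_idx q).2).

Definition ptraceA (m n : nat) (rho : 'M[C]_(m * n)) : 'M[C]_n :=
  \matrix_(k, l) \sum_(i < m) rho (mxvec_index i k) (mxvec_index i l).
Definition ptraceB (m n : nat) (rho : 'M[C]_(m * n)) : 'M[C]_m :=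
  \matrix_(i, j) \sum_(k < n) rho (mxvec_index i k) (mxvec_index j k).

Definition prob (dA dB : nat) (rho : 'M[C]_(dA * dB))
  (MAa : 'M[C]_dA) (MBb : 'M[C]_dB) : C :=
  \tr (kron MAa MBb *m rho).

Definition is_distribution (n : nat) (p : 'I_n -> C) : Prop :=
  (forall l, 0 <= p l) /\ \sum_(l < n) p l = 1.

Definition is_response (d n : nat)
  (r : forall k : nat, ('I_k -> 'M[C]_d) -> 'I_n -> 'I_k -> C) : Prop :=
  forall (k : nat) (M : 'I_k -> 'M[C]_d), is_POVM M ->
    forall l : 'I_n, is_distribution (r k M l).

(* NOT EPR steerable from Bob to Alice: LHS model with quantum states on Alice *)
Definition unsteerable_BA (dA dB : nat) (rho : 'M[C]_(dA * dB)) : Prop :=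
  exists (n : nat) (p : 'I_n -> C) (sA : 'I_n -> 'M[C]_dA)
         (rB : forall k : nat, ('I_k -> 'M[C]_dB) -> 'I_n -> 'I_k -> C),
    [/\ is_distribution p, (forall l, is_state (sA l)), is_response rB &
      forall (kA kB : nat) (MA : 'I_kA -> 'M[C]_dA) (MB : 'I_kB -> 'M[C]_dB),
        is_POVM MA -> is_POVM MB ->
        forall (a : 'I_kA) (b : 'I_kB),
          prob rho (MA a) (MB b) =
          \sum_(l < n) p l * \tr (sA l *m MA a) * rB kB MB l b].

(* NOT EPR steerable from Alice to Bob: LHS model with quantum states on Bob *)
Definition unsteerable_AB (dA dB : nat) (rho : 'M[C]_(dA * dB)) : Prop :=
  exists (n : nat) (p : 'I_n -> C)
         (rA : forall k : nat, ('I_k -> 'M[C]_dA) -> 'I_n -> 'I_k -> C)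
         (sB : 'I_n -> 'M[C]_dB),
    [/\ is_distribution p, is_response rA, (forall l, is_state (sB l)) &
      forall (kA kB : nat) (MA : 'I_kA -> 'M[C]_dA) (MB : 'I_kB -> 'M[C]_dB),
        is_POVM MA -> is_POVM MB ->
        forall (a : 'I_kA) (b : 'I_kB),
          prob rho (MA a) (MB b) =
          \sum_(l < n) p l * rA kA MA l a * \tr (sB l *m MB b)].

Definition steerable_BA (dA dB : nat) (rho : 'M[C]_(dA * dB)) : Prop :=
  ~ unsteerable_BA rho.
Definition steerable_AB (dA dB : nat) (rho : 'M[C]_(dA * dB)) : Prop :=
  ~ unsteerable_AB rho.

Definition separable (dA dB : nat) (rho : 'M[C]_(dA * dB)) : Prop :=
  exists (n : nat) (p : 'I_n -> C) (sA : 'I_n -> 'M[C]_dA) (sB : 'I_n -> 'M[C]_dB),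
    [/\ is_distribution p, (forall l, is_state (sA l)), (forall l, is_state (sB l)) &
      rho = \sum_(l < n) p l *: kron (sA l) (sB l)].

Definition entangled (dA dB : nat) (rho : 'M[C]_(dA * dB)) : Prop :=
  ~ separable rho.

End Quantum.

(* Main.v *)
Require Import Defs.
From HB Require Import structures.
From mathcomp Require Import all_boot all_order all_algebra.
From mathcomp Require Import ring.
Import Order.TTheory GRing.Theory Num.Theory.
Local Open Scope ring_scope.
Set Implicit Arguments. Unset Strict Implicit. Unset Printing Implicit Defensive.

(* Suppose [rho] has a local hidden state model: weights [p l], quantum states on the
   steered side and arbitrary responses on the qubit side.  For each hidden variable [l]
   the responses to the three Pauli measurements have biases [g_c] in [[-1, 1]]; the qubit
   with Bloch vector [mu * g] is a state since [|mu * g| <= mu * sqrt 3 <= 1], and on each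
   Pauli projector it yields [mu * response + (1 - mu) / 2].  So the separable matrix
   [\sum_l p l *: (steered state) (x) (this qubit)] has the same statistics as [tau] on all
   products of POVM effects and Pauli projectors.  These span the matrices on both factors,
   hence [tau] is that separable state. *)

Section LocalHiddenStates.
Variable C : numClosedFieldType.
Implicit Types z : C.

Lemma ord2P (b : 'I_2) : b = 0 \/ b = 1.
Proof. by case: b => [[|[|//]] ?]; [left|right]; apply: val_inj. Qed.

Lemma ord3P (c : 'I_3) : [\/ c = 0, c = 1 | c = 2].
Proof.
by case: c => [[|[|[|//]]] ?]; [constructor 1|constructor 2|constructor 3]; apply: val_inj.
Qed.

Lemma big_ord2 (R : nmodType) (F : 'I_2 -> R) : \sum_(i < 2) F i = F 0 + F 1.
Proof. by rewrite big_ord_recl big_ord1; congr (_ + F _); apply: val_inj. Qed.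

Lemma big_ord3 (R : nmodType) (F : 'I_3 -> R) : \sum_(i < 3) F i = F 0 + F 1 + F 2.
Proof.
by rewrite !big_ord_recl big_ord0 addr0 addrA; congr (F _ + F _ + F _); apply: val_inj.
Qed.

Lemma unit_neq0 z : z * z^* = 1 -> z != 0.
Proof. by move=> zu; apply: contra_eq_neq zu => ->; rewrite mul0r eq_sym oner_neq0. Qed.

Lemma unit_conjE z : z * z^* = 1 -> z^* = z^-1.
Proof. by move=> zu; rewrite -[z^-1]mulr1 -zu mulKf ?unit_neq0. Qed.

(* Lets [field], which treats ['i] as an indeterminate, prove identities that hold
   only modulo ['i * 'i = -1]. *)
Lemma eq_modCii (x y k : C) : x = y + k * ('i * 'i + 1) -> x = y.
Proof. by rewrite mulCii addNr mulr0 addr0. Qed.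

(** * Kronecker products and joint probabilities *)

Lemma tens_idxK m n (i : 'I_m) (j : 'I_n) : tens_idx (mxvec_index i j) = (i, j).
Proof. by rewrite /tens_idx /mxvec_index cast_ordK enum_rankK. Qed.

Lemma mxvec_index_inj m n (i i' : 'I_m) (k k' : 'I_n) :
  (mxvec_index i k == mxvec_index i' k') = (i == i') && (k == k').
Proof.
apply/eqP/andP => [h|[/eqP -> /eqP ->]] //.
by have := congr1 (@tens_idx m n) h; rewrite !tens_idxK => -[-> ->].
Qed.

Lemma big_mxvec_index m n (f : 'I_(m * n) -> C) :
  \sum_(p < m * n) f p = \sum_(i < m) \sum_(k < n) f (mxvec_index i k).
Proof.
rewrite pair_bigA (reindex (fun u : 'I_m * 'I_n => mxvec_index u.1 u.2)) //=.
exists (@tens_idx m n) => [[i k] _|p _]; first by rewrite tens_idxK.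
by case/mxvec_indexP: p => i k; rewrite tens_idxK.
Qed.

Lemma kronE m n (A : 'M[C]_m) (B : 'M[C]_n) i k j l :
  kron A B (mxvec_index i k) (mxvec_index j l) = A i j * B k l.
Proof. by rewrite mxE !tens_idxK. Qed.

Lemma mulmx_kron m n (A X : 'M[C]_m) (B Y : 'M[C]_n) :
  kron A B *m kron X Y = kron (A *m X) (B *m Y).
Proof.
apply/matrixP => p q; case/mxvec_indexP: p => i k; case/mxvec_indexP: q => j l.
rewrite mxE kronE !mxE big_mxvec_index big_distrlr /=.
by apply: eq_bigr => a _; apply: eq_bigr => b _; rewrite !kronE; ring.
Qed.

Lemma mxtrace_kron m n (A : 'M[C]_m) (B : 'M[C]_n) : \tr (kron A B) = \tr A * \tr B.
Proof.
rewrite /mxtrace big_mxvec_index big_distrlr /=.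
by apply: eq_bigr => i _; apply: eq_bigr => k _; rewrite kronE.
Qed.

Lemma kron_delta m n (i j : 'I_m) (k l : 'I_n) :
  kron (delta_mx i j) (delta_mx k l) =
  delta_mx (mxvec_index i k) (mxvec_index j l) :> 'M[C]_(m * n).
Proof.
apply/matrixP => p q; case/mxvec_indexP: p => i' k'; case/mxvec_indexP: q => j' l'.
by rewrite kronE !mxE !mxvec_index_inj -natrM mulnb andbACA.
Qed.

Lemma linear_kronl m n (B : 'M[C]_n) : linear (fun A : 'M[C]_m => kron A B).
Proof. by move=> a A A'; apply/matrixP => p q; rewrite !mxE; ring. Qed.

Lemma linear_kronr m n (A : 'M[C]_m) : linear (fun B : 'M[C]_n => kron A B).
Proof. by move=> a B B'; apply/matrixP => p q; rewrite !mxE; ring. Qed.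

Section Prob.
Variables m n : nat.
Implicit Types (X Y : 'M[C]_(m * n)) (E : 'M[C]_m) (F : 'M[C]_n).

Lemma probD X Y E F : prob (X + Y) E F = prob X E F + prob Y E F.
Proof. by rewrite /prob !linearD. Qed.

Lemma probB X Y E F : prob (X - Y) E F = prob X E F - prob Y E F.
Proof. by rewrite /prob !linearB. Qed.

Lemma probZ a X E F : prob (a *: X) E F = a * prob X E F.
Proof. by rewrite /prob !linearZ. Qed.

Lemma prob_sum k (X : 'I_k -> 'M[C]_(m * n)) E F :
  prob (\sum_(l < k) X l) E F = \sum_(l < k) prob (X l) E F.
Proof. by rewrite /prob !linear_sum. Qed.

Lemma prob_kron (A : 'M[C]_m) (B : 'M[C]_n) E F :
  prob (kron A B) E F = \tr (A *m E) * \tr (B *m F).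
Proof. by rewrite /prob mulmx_kron mxtrace_kron !(mxtrace_mulC A) (mxtrace_mulC B). Qed.

Lemma linear_probl X F : linear_for *%R (fun E => prob X E F).
Proof. by move=> a E E'; rewrite /prob linear_kronl mulmxDl -scalemxAl mxtraceD mxtraceZ. Qed.

Lemma linear_probr X E : linear_for *%R (fun F => prob X E F).
Proof. by move=> a F F'; rewrite /prob linear_kronr mulmxDl -scalemxAl mxtraceD mxtraceZ. Qed.

End Prob.

Lemma mxtrace_delta_mul n (a b : 'I_n) (X : 'M[C]_n) : \tr (delta_mx a b *m X) = X b a.
Proof.
rewrite /mxtrace (bigD1 a) //= big1 => [|p /negbTE pa]; last first.
  by rewrite mxE big1 // => q _; rewrite mxE pa mul0r.
rewrite mxE (bigD1 b) //= big1 => [|q /negbTE qb]; last by rewrite mxE qb andbF mul0r.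
by rewrite mxE !eqxx mul1r !addr0.
Qed.

Lemma prob_delta m n (X : 'M[C]_(m * n)) i j k l :
  prob X (delta_mx i j) (delta_mx k l) = X (mxvec_index j l) (mxvec_index i k).
Proof. by rewrite /prob kron_delta mxtrace_delta_mul. Qed.

Lemma prob_mx1r m n (X : 'M[C]_(m * n)) E : prob X E 1%:M = \tr (ptraceB X *m E).
Proof.
rewrite mxtrace_mulC /prob /mxtrace big_mxvec_index; apply: eq_bigr => i _.
rewrite mxE; under eq_bigr do rewrite mxE big_mxvec_index.
rewrite exchange_big; apply: eq_bigr => j _; rewrite mxE big_distrr; apply: eq_bigr => k _.
rewrite (bigD1 k) //= big1 => [|l /negbTE lk]; last by rewrite kronE !mxE eq_sym lk mulr0 mul0r.
by rewrite kronE !mxE eqxx mulr1 addr0.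
Qed.

Lemma prob_mx1l m n (X : 'M[C]_(m * n)) F : prob X 1%:M F = \tr (ptraceA X *m F).
Proof.
rewrite mxtrace_mulC /prob /mxtrace big_mxvec_index exchange_big; apply: eq_bigr => k _.
rewrite mxE; under eq_bigr do rewrite mxE big_mxvec_index.
under [RHS]eq_bigr do rewrite mxE big_distrr.
rewrite [RHS]exchange_big; apply: eq_bigr => i _.
rewrite (bigD1 i) //= [X in _ + X]big1 => [|j /negbTE ji]; last first.
  by rewrite big1 // => l _; rewrite kronE !mxE eq_sym ji !mul0r.
by rewrite addr0; apply: eq_bigr => l _; rewrite kronE !mxE eqxx mul1r.
Qed.

(** * Positive semidefinite matrices *)

Lemma adjmxE m n (A : 'M[C]_(m, n)) i j : adjmx A i j = (A j i)^*.
Proof. by rewrite !mxE. Qed.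

Lemma psdP n (A : 'M[C]_n) :
  (forall x y, A y x = (A x y)^*) ->
  (forall v : 'I_n -> C, 0 <= \sum_x \sum_y (v x)^* * A x y * v y) -> psd A.
Proof.
move=> hA hv; split=> [|v]; first by apply/matrixP => x y; rewrite adjmxE -hA.
rewrite mxE; under eq_bigr do rewrite mxE big_distrl /=.
rewrite exchange_big /=; under eq_bigr do under eq_bigr do rewrite adjmxE.
exact: (hv (fun x => v x 0)).
Qed.

Definition rank1 n (c : C) (w : 'I_n -> C) : 'M[C]_n := \matrix_(x, y) (c * (w x * (w y)^*)).

Lemma psd_rank1 n (c : C) (w : 'I_n -> C) : 0 <= c -> psd (rank1 c w).
Proof.
move=> c_ge0; apply: psdP => [x y|v].
  by rewrite !mxE !rmorphM /= conjCK (geC0_conj c_ge0) (mulrC (w y)).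
have -> : \sum_x \sum_y (v x)^* * rank1 c w x y * v y =
          c * ((\sum_y (w y)^* * v y)^* * (\sum_y (w y)^* * v y)).
  rewrite rmorph_sum big_distrl big_distrr /=; apply: eq_bigr => x _.
  rewrite !big_distrr /=; apply: eq_bigr => y _.
  by rewrite mxE !rmorphM /= conjCK; ring.
by rewrite mulr_ge0 // mulrC mul_conjC_ge0.
Qed.

Lemma psd_diag_mx n (d : 'rV[C]_n) : (forall x, 0 <= d 0 x) -> psd (diag_mx d).
Proof.
move=> d_ge0; apply: psdP => [x y|v].
  by rewrite !mxE rmorphMn /= geC0_conj // eq_sym; case: eqVneq => [->|].
apply: sumr_ge0 => x _; rewrite (bigD1 x) //= big1 => [|y /negbTE yx]; last first.
  by rewrite mxE eq_sym yx mulr0 mul0r.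
by rewrite addr0 mxE eqxx mulr1n mulrAC mulr_ge0 // mulrC mul_conjC_ge0.
Qed.

Lemma psd_delta n (a : 'I_n) : psd (delta_mx a a : 'M[C]_n).
Proof.
have -> : delta_mx a a = diag_mx (delta_mx 0 a) :> 'M[C]_n.
  apply/matrixP => x y; rewrite !mxE eqxx /=.
  by have [->|_] := eqVneq x a; rewrite ?mul0rn // eq_sym; case: (a == y).
by apply: psd_diag_mx => x; rewrite mxE ler0n.
Qed.

Lemma psd_mx1 n : psd (1%:M : 'M[C]_n).
Proof. by rewrite -diag_const_mx; apply: psd_diag_mx => x; rewrite mxE ler01. Qed.


Lemma state_mx2 (B : 'M[C]_2) :
  (forall x y, B y x = (B x y)^*) -> \tr B = 1 ->
  0 <= B 0 0 * B 1 1 - B 0 1 * B 1 0 -> is_state B.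
Proof.
move=> hB trB detB; split=> //; apply: psdP => // v.
rewrite !big_ord2; move: trB; rewrite /mxtrace big_ord2 => trB.
have [a_real b_real] : (B 0 0)^* = B 0 0 /\ (B 1 1)^* = B 1 1 by split; rewrite -hB.
move: trB detB a_real b_real; rewrite (hB 0 1).
move: (B 0 0) (B 1 1) (B 0 1) (v 0) (v 1) => a b z v0 v1 trB detB a_real b_real.
(* multiply the form by the trace [a + b = 1] and complete the squares *)
have -> : v0^* * a * v0 + v0^* * z * v1 + (v1^* * z^* * v0 + v1^* * b * v1)
   = (a * v0 + z * v1) * (a * v0 + z * v1)^* + (a * b - z * z^*) * (v1 * v1^*)
     + ((b * v1 + z^* * v0) * (b * v1 + z^* * v0)^* + (a * b - z * z^*) * (v0 * v0^*)).
  rewrite !rmorphD !rmorphM /= a_real b_real conjCK -[LHS]mul1r -trB; ring.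
by rewrite !addr_ge0 ?mul_conjC_ge0 ?(mulr_ge0 detB (mul_conjC_ge0 _)).
Qed.

(** * Spanning families of effects *)

Definition pair_proj n (i j : 'I_n) (z : C) : 'M[C]_n :=
  rank1 2^-1 (fun x => (x == i)%:R + z * (x == j)%:R).

Lemma pair_projE n (i j : 'I_n) z x y :
  pair_proj i j z x y =
  2^-1 * (((x == i)%:R + z * (x == j)%:R) * ((y == i)%:R + z^* * (y == j)%:R)).
Proof. by rewrite mxE !rmorphD !rmorphM /= !conjC_nat. Qed.

Lemma psd_pair_proj n (i j : 'I_n) z : psd (pair_proj i j z).
Proof. by apply: psd_rank1; rewrite invr_ge0 ler0n. Qed.

Lemma pair_projC n (i j : 'I_n) z : z * z^* = 1 -> pair_proj j i z = pair_proj i j z^*.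
Proof.
move=> zu; apply/matrixP => x y; rewrite !pair_projE conjCK unit_conjE //.
by field; rewrite unit_neq0.
Qed.

Lemma add_pair_proj n (i j : 'I_n) z : z * z^* = 1 ->
  pair_proj i j z + pair_proj i j (- z) = delta_mx i i + delta_mx j j.
Proof.
move=> zu; apply/matrixP => x y; rewrite [LHS]mxE !pair_projE !mxE rmorphN /= unit_conjE //.
by rewrite -!mulnb !natrM; field; rewrite unit_neq0.
Qed.

Definition phases : seq C := [:: 1; -1; 'i; -'i].

Lemma phase_unit z : z \in phases -> z * z^* = 1.
Proof.
rewrite !inE => /or4P[] /eqP->;
  by rewrite ?rmorphN /= ?conjC1 ?conjCi ?mulrNN ?mulr1 // mulrN mulCii opprK.
Qed.

Lemma phaseC z : z \in phases -> z^* \in phases.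
Proof.
by rewrite !inE => /or4P[] /eqP->; rewrite ?rmorphN /= ?conjC1 ?conjCi ?opprK eqxx ?orbT.
Qed.

Lemma delta_mx_phases n (i j : 'I_n) :
  delta_mx i j = \sum_(z <- phases) (z / 2) *: pair_proj i j z.
Proof.
apply/matrixP => x y; rewrite summxE !big_cons big_nil !mxE.
rewrite !(rmorphD, rmorphM, rmorphN) /= !conjC_nat conjC1 conjCi opprK -mulnb natrM.
move: ((x == i)%:R : C) ((x == j)%:R : C) ((y == i)%:R : C) ((y == j)%:R : C) => Ix Jx Iy Jy.
by apply/esym/(@eq_modCii _ _ ((Jx * Iy - Ix * Jy) / 2)); field.
Qed.

Definition spans n (S : 'M[C]_n -> Prop) :=
  forall L : 'M[C]_n -> C, linear_for *%R L ->
  (forall E, S E -> L E = 0) -> forall i j, L (delta_mx i j) = 0.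

Lemma linear_sum_eq0 n (L : 'M[C]_n -> C) (s : seq C) (c : C -> C) (A : C -> 'M[C]_n) :
  linear_for *%R L -> (forall z, z \in s -> L (A z) = 0) ->
  L (\sum_(z <- s) c z *: A z) = 0.
Proof.
move=> hL; elim: s => [_|z s IHs hs]; last first.
  rewrite big_cons hL hs ?mem_head // IHs ?mulr0 ?addr0 // => z' hz'.
  by rewrite hs // inE hz' orbT.
have := hL 1 0 0; rewrite scale1r addr0 mul1r big_nil => /(congr1 (fun t => t - L 0)).
by rewrite subrr addrK => ->.
Qed.

Lemma spans_pairs n (S : 'M[C]_n -> Prop) :
  (forall a, S (delta_mx a a)) ->
  (forall i j z, i != j -> z \in phases -> S (pair_proj i j z)) -> spans S.
Proof.
move=> Sdelta Spair L hL LS i j; have [->|ij] := eqVneq i j; first exact/LS/Sdelta.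
by rewrite delta_mx_phases; apply: linear_sum_eq0 => // z hz; apply/LS/Spair.
Qed.

Lemma is_POVM_delta n : is_POVM (fun a : 'I_n => delta_mx a a : 'M[C]_n).
Proof. by split=> [a|]; [exact: psd_delta | rewrite -mx1_sum_delta]. Qed.

Lemma is_POVM_mx1 n : is_POVM (fun _ : 'I_1 => 1%:M : 'M[C]_n).
Proof. by split=> [_|]; [exact: psd_mx1 | rewrite big_ord1]. Qed.

Definition pair_povm n (i j : 'I_n) z : 'I_3 -> 'M[C]_n :=
  nth 0 [:: pair_proj i j z; pair_proj i j (- z); diag_mx (\row_x ((x != i) && (x != j))%:R)].

Lemma is_POVM_pair n (i j : 'I_n) z : i != j -> z * z^* = 1 -> is_POVM (pair_povm i j z).
Proof.
move=> ij zu; split=> [[[|[|[|]]]] // ?|]; rewrite /pair_povm /=; try exact: psd_pair_proj.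
  by apply: psd_diag_mx => x; rewrite mxE ler0n.
rewrite !big_ord_recl big_ord0 /= addr0 addrA add_pair_proj //.
apply/matrixP => x y; rewrite !mxE.
have [->|xi] := eqVneq x i; first by rewrite (negbTE ij) mul0rn !addr0 eq_sym.
have [->|xj] := eqVneq x j; first by rewrite mul0rn add0r addr0 eq_sym.
by rewrite mulr1n !add0r.
Qed.

Definition is_effect n (E : 'M[C]_n) := exists k (M : 'I_k -> 'M[C]_n) a, is_POVM M /\ E = M a.

Lemma spans_effects n : spans (@is_effect n).
Proof.
apply: spans_pairs => [a|i j z ij /phase_unit zu].
  by exists n, (fun a => delta_mx a a), a; split=> //; apply: is_POVM_delta.
by exists 3, (pair_povm i j z), 0; split=> //; apply: is_POVM_pair.
Qed.

Lemma prob_inj m n (X Y : 'M[C]_(m * n)) (SA : 'M[C]_m -> Prop) (SB : 'M[C]_n -> Prop) :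
  spans SA -> spans SB ->
  (forall E F, SA E -> SB F -> prob X E F = prob Y E F) -> X = Y.
Proof.
move=> hA hB hXY; apply/eqP; rewrite -subr_eq0; apply/eqP/matrixP => p q.
case/mxvec_indexP: p => a b; case/mxvec_indexP: q => c d.
rewrite -(prob_delta _ c a d b) mxE.
apply: (hB (prob (X - Y) (delta_mx c a))) => [|F SF]; first exact: linear_probr.
apply: (hA (prob (X - Y) ^~ F)) => [|E SE]; first exact: linear_probl.
by rewrite probB hXY // subrr.
Qed.

(* [pauli c b] is the projector onto the eigenvalue [(-1)^b] of sigma_z, sigma_x, sigma_y
   for [c = 0, 1, 2]; the Bloch vector [v] of [bloch v] is indexed the same way. *)
Definition pauli (c : 'I_3) (b : 'I_2) : 'M[C]_2 :=
  if c == 0 then delta_mx b b else pair_proj 0 1 ((-1) ^+ b * 'i ^+ c.-1).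

Lemma pauli_Z b : pauli 0 b = delta_mx b b.
Proof. by []. Qed.

Lemma pauli_X b : pauli 1 b = pair_proj 0 1 ((-1) ^+ b).
Proof. by rewrite -[(-1) ^+ b in RHS]mulr1. Qed.

Lemma pauli_Y b : pauli 2 b = pair_proj 0 1 ((-1) ^+ b * 'i).
Proof. by []. Qed.

Lemma is_POVM_pauli c : is_POVM (pauli c).
Proof.
rewrite /pauli; case: eqP => _; first exact: is_POVM_delta.
split=> [b|]; first exact: psd_pair_proj.
rewrite big_ord2 expr0 mul1r expr1 mulN1r add_pair_proj ?mx1_sum_delta ?big_ord2 //.
by rewrite -normCK normrX normCi !expr1n.
Qed.

Lemma pauli_phases z : z \in phases -> exists c b, pair_proj 0 1 z = pauli c b.
Proof.
rewrite !inE => /or4P[] /eqP->; [exists 1, 0 | exists 1, 1 | exists 2, 0 | exists 2, 1];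
  by rewrite ?pauli_X ?pauli_Y ?expr0 ?expr1 ?mul1r ?mulN1r.
Qed.

Lemma spans_pauli : spans (fun F => exists c b, F = pauli c b).
Proof.
apply: spans_pairs => [a|i j z ij hz]; first by exists 0, a.
have [[-> ->]|[-> ->]] : (i, j) = (0, 1) \/ (i, j) = (1, 0).
  by move: i j ij => [[|[|//]] ?] [[|[|//]] ?] //= _; [left|right]; congr pair; apply: val_inj.
  by have [c [b ->]] := pauli_phases hz; exists c, b.
rewrite pair_projC ?phase_unit //.
by have [c [b ->]] := pauli_phases (phaseC hz); exists c, b.
Qed.

(** * Qubit states with a prescribed Bloch vector *)

Definition bloch (v : 'I_3 -> C) : 'M[C]_2 :=
  \matrix_(x, y) (2^-1 * if x == 0 then if y == 0 then 1 + v 0 else v 1 - 'i * v 2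
                         else if y == 0 then v 1 + 'i * v 2 else 1 - v 0).

Lemma bloch0 : bloch (fun _ => 0) = 2^-1 *: 1%:M.
Proof.
apply/matrixP => x y; rewrite !mxE.
by move: x y => [[|[|//]] ?] [[|[|//]] ?]; rewrite /= ?(mulr0, addr0, subr0).
Qed.

Lemma mxtrace_mulmx2 (A B : 'M[C]_2) :
  \tr (A *m B) = A 0 0 * B 0 0 + A 0 1 * B 1 0 + (A 1 0 * B 0 1 + A 1 1 * B 1 1).
Proof. by rewrite /mxtrace big_ord2 !mxE !big_ord2. Qed.

Lemma mxtrace_bloch_pair v z : z * z^* = 1 ->
  \tr (bloch v *m pair_proj 0 1 z) =
  2^-1 * (1 + (v 1 * (z + z^*) + 'i * v 2 * (z^* - z)) / 2).
Proof.
move=> zu; rewrite mxtrace_mulmx2 !pair_projE !mxE /= unit_conjE //.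
by field; rewrite unit_neq0.
Qed.

Lemma mxtrace_bloch_pauli v c b :
  \tr (bloch v *m pauli c b) = 2^-1 * (1 + (-1) ^+ b * v c).
Proof.
case: (ord3P c) => ->; rewrite ?pauli_Z ?pauli_X ?pauli_Y.
- rewrite mxtrace_mulC mxtrace_delta_mul mxE.
  by case: (ord2P b) => ->; rewrite /= ?expr0 ?mul1r ?expr1 ?mulN1r.
- rewrite (mxtrace_bloch_pair v); last by rewrite -normCK normrX normrN1 expr1n expr1n.
  by case: (ord2P b) => ->; rewrite /= ?expr0 ?expr1 ?rmorphN /= conjC1; field.
- rewrite (mxtrace_bloch_pair v); last first.
    by rewrite -normCK normrM normrX normrN1 normCi !(expr1n, mulr1).
  apply: (@eq_modCii _ _ (- (-1) ^+ b * v 2 / 2)).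
  by case: (ord2P b) => ->; rewrite /= ?expr0 ?expr1 ?mul1r ?mulN1r ?rmorphN /= conjCi; field.
Qed.

Lemma bloch_state v :
  (forall c, (v c)^* = v c) -> \sum_c v c ^+ 2 <= 1 -> is_state (bloch v).
Proof.
move=> v_real v_le1; apply: state_mx2.
- have conj_half : (2^-1 : C)^* = 2^-1 by rewrite fmorphV /= conjC_nat.
  move=> x y; rewrite !mxE; case: (ord2P x) => ->; case: (ord2P y) => ->;
  by rewrite /= !(rmorphM, rmorphD, rmorphN) /= conj_half ?conjC1 ?conjCi !v_real ?mulNr ?opprK.
- by rewrite /mxtrace big_ord2 !mxE /=; field.
have -> : bloch v 0 0 * bloch v 1 1 - bloch v 0 1 * bloch v 1 0 =
          4^-1 * (1 - \sum_c v c ^+ 2).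
  by rewrite big_ord3 !mxE /=; apply: (@eq_modCii _ _ (v 2 ^+ 2 / 4)); field.
by apply: mulr_ge0; rewrite ?invr_ge0 ?ler0n ?subr_ge0.
Qed.

(** * Local hidden states *)

Lemma distribution1 (q : 'I_1 -> C) : is_distribution q -> q 0 = 1.
Proof. by case=> _; rewrite big_ord1. Qed.

Lemma distribution2 (q : 'I_2 -> C) : is_distribution q -> q 0 + q 1 = 1.
Proof. by case=> _; rewrite big_ord2. Qed.

Lemma sqr_bias_le1 (q : 'I_2 -> C) : is_distribution q -> (q 0 - q 1) ^+ 2 <= 1.
Proof.
move=> hq; have [q_ge0 _] := hq.
rewrite -subr_ge0 -(expr1n C 2) -(distribution2 hq).
by rewrite subr_sqrDB mulrn_wge0 ?mulr_ge0.
Qed.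

Definition lhs_qubit (mu : C) (q : 'I_3 -> 'I_2 -> C) : 'M[C]_2 :=
  bloch (fun c => mu * (q c 0 - q c 1)).

Lemma lhs_qubit_state mu q : 0 <= mu -> mu <= (sqrtC 3)^-1 ->
  (forall c, is_distribution (q c)) -> is_state (lhs_qubit mu q).
Proof.
move=> mu_ge0 mu_le hq; have q_ge0 c b : 0 <= q c b by case: (hq c).
apply: bloch_state => [c|]; first by rewrite rmorphM rmorphB /= !geC0_conj.
have mu2 : mu ^+ 2 <= 3^-1 by rewrite -(sqrtCK 3) -exprVn !expr2 ler_pM.
have third_sum : \sum_(c < 3) 3^-1 = 1 :> C by rewrite big_ord3; field.
rewrite -third_sum; apply: ler_sum => c _; rewrite exprMn -[3^-1]mulr1.
apply: ler_pM => //; [exact: exprn_ge0 | | exact: sqr_bias_le1].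
by rewrite -realEsqr rpredB ?ger0_real.
Qed.

Lemma mxtrace_lhs_qubit mu q c b : is_distribution (q c) ->
  \tr (lhs_qubit mu q *m pauli c b) = mu * q c b + (1 - mu) / 2.
Proof.
move=> /distribution2 hq; rewrite mxtrace_bloch_pauli.
case: (ord2P b) => -> /=; rewrite -[q c 1](addKr (q c 0)) hq;
  by rewrite ?expr0 ?expr1 ?mul1r ?mulN1r; field.
Qed.

Lemma steerable_BA_of_entangled_mix d (rho : 'M[C]_(d * 2)) mu :
  0 <= mu -> mu <= (sqrtC 3)^-1 ->
  entangled (mu *: rho + (1 - mu) *: kron (ptraceB rho) (2^-1 *: (1%:M : 'M[C]_2))) ->
  steerable_BA rho.
Proof.
move=> mu_ge0 mu_le tau_ent [n [p [sA [rB [p_dist sA_state rB_resp model]]]]]; apply: tau_ent.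
pose q l c := rB 2 (pauli c) l.
have q_dist l c : is_distribution (q l c) := rB_resp 2 _ (is_POVM_pauli c) l.
exists n, p, sA, (fun l => lhs_qubit mu (q l)); split=> // [l|]; first exact: lhs_qubit_state.
apply: (prob_inj (@spans_effects d) spans_pauli) => _ _ [k [M [a [M_povm ->]]]] [c [b ->]].
rewrite probD !probZ prob_kron -prob_mx1r -bloch0 mxtrace_bloch_pauli mulr0 addr0 mulr1.
rewrite (model _ _ _ _ M_povm (is_POVM_pauli c)) (model _ _ _ _ M_povm (is_POVM_mx1 2) a 0).
rewrite prob_sum; under [RHS]eq_bigr do rewrite probZ prob_kron mxtrace_lhs_qubit //.
rewrite mulr_suml !mulr_sumr -big_split; apply: eq_bigr => l _.
by rewrite (distribution1 (rB_resp _ _ (is_POVM_mx1 2) l)) /q /=; ring.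
Qed.

Lemma steerable_AB_of_entangled_mix d (rho : 'M[C]_(2 * d)) mu :
  0 <= mu -> mu <= (sqrtC 3)^-1 ->
  entangled (mu *: rho + (1 - mu) *: kron (2^-1 *: (1%:M : 'M[C]_2)) (ptraceA rho)) ->
  steerable_AB rho.
Proof.
move=> mu_ge0 mu_le tau_ent [n [p [rA [sB [p_dist rA_resp sB_state model]]]]]; apply: tau_ent.
pose q l c := rA 2 (pauli c) l.
have q_dist l c : is_distribution (q l c) := rA_resp 2 _ (is_POVM_pauli c) l.
exists n, p, (fun l => lhs_qubit mu (q l)), sB; split=> // [l|]; first exact: lhs_qubit_state.
apply: (prob_inj spans_pauli (@spans_effects d)) => _ _ [c [b ->]] [k [M [a [M_povm ->]]]].
rewrite probD !probZ prob_kron -prob_mx1l -bloch0 mxtrace_bloch_pauli mulr0 addr0 mulr1.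
rewrite (model _ _ _ _ (is_POVM_pauli c) M_povm) (model _ _ _ _ (is_POVM_mx1 2) M_povm 0 a).
rewrite prob_sum; under [RHS]eq_bigr do rewrite probZ prob_kron mxtrace_lhs_qubit //.
rewrite !mulr_sumr -big_split; apply: eq_bigr => l _.
by rewrite (distribution1 (rA_resp _ _ (is_POVM_mx1 2) l)) /q /=; ring.
Qed.

End LocalHiddenStates.

Theorem mainTheorem3 (C : numClosedFieldType) (d : nat) (hd : (2 <= d)%N) :
  (* (i): Alice holds the qudit C^d, Bob the qubit C^2 *)
  (forall (rho : 'M[C]_(d * 2)) (mu1 : C),
     is_state rho -> 0 <= mu1 -> mu1 <= (sqrtC 3)^-1 ->
     entangled (mu1 *: rho + (1 - mu1) *: kron (ptraceB rho) (2^-1 *: (1%:M : 'M[C]_2))) ->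
     steerable_BA rho)
  /\
  (* (ii): Alice holds the qubit C^2, Bob the qudit C^d *)
  (forall (rho : 'M[C]_(2 * d)) (mu2 : C),
     is_state rho -> 0 <= mu2 -> mu2 <= (sqrtC 3)^-1 ->
     entangled (mu2 *: rho + (1 - mu2) *: kron (2^-1 *: (1%:M : 'M[C]_2)) (ptraceA rho)) ->
     steerable_AB rho).
Proof.
split=> rho mu _; [exact: steerable_BA_of_entangled_mix | exact: steerable_AB_of_entangled_mix].
Qed.
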